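(* Let $\xi\sim N(\mu,\Sigma)$ be a jointly distributed Gaussian random vector in $\mathbb{R}^n$ with mean $\mu$ and positive definite covariance matrix $\Sigma$, let $0<\epsilon\le\frac12$, and let $LL^T=\Sigma$ be the Cholesky decomposition of $\Sigma$. Consider, for $(a,b,x)\in\mathbb{R}\times\mathbb{R}\times\mathbb{R}^n$ and an additional variable $t\in\mathbb{R}$, the system $$t\ge\|L^Tx\|_2,\qquad a-\mu^Tx\le\Phi^{-1}(\epsilon)\,t,\qquad b-\mu^Tx\ge\Phi^{-1}(1-\epsilon)\,t,\qquad a-b\le 2\Phi^{-1}(\epsilon/2)\,t .$$ This extended formulation is a second-order cone outer approximation of the constraint $\mathbb{P}(a\le x^T\xi\le b)\ge 1-\epsilon$; that is, for every $(a,b,x)$ satisfying $\mathbb{P}(a\le x^T\xi\le b)\ge 1-\epsilon$ there exists $t$ such that the system holds. Moreover, if $(a,b,x,t)$ satisfies the system for some $t$, then $$\mathbb{P}(a\le x^T\xi\le b)\ge 1-1.25\,\epsilon.$$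
   Context: $\Phi$ is the cumulative distribution function of the standard Gaussian distribution, and $\Phi^{-1}$ its inverse. *)

(* Defs.v *)
From HB Require Import structures.
From mathcomp Require Import all_boot all_order all_algebra.
From mathcomp Require Import all_classical all_reals all_analysis.

Set Implicit Arguments.
Unset Strict Implicit.
Unset Printing Implicit Defensive.

Import Order.TTheory GRing.Theory Num.Theory.
Import numFieldNormedType.Exports.

Local Open Scope classical_set_scope.
Local Open Scope ring_scope.

Definition Phi {R : realType} (r : R) : R :=
  fine (normal_prob (0 : R) 1 `]-oo, r]).

(* [pinv] is the inverse on the range of Phi, i.e. on the open interval
   ]0, 1[; its value elsewhere is irrelevant. *)
Definition Phi_inv {R : realType} : R -> R := pinv [set: R] (@Phi R).

Definition dotv {R : realType} {n : nat} (u v : 'cV[R]_n) : R :=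
  (u^T *m v) 0 0.

(* The norm `|v| carried by matrices in the library is the sup norm. *)
Definition l2norm {R : realType} {n : nat} (v : 'cV[R]_n) : R :=
  Num.sqrt (\sum_i v i 0 ^+ 2).

Definition posdef {R : realType} {n : nat} (A : 'M[R]_n) : Prop :=
  A^T = A /\ forall v : 'cV[R]_n, v != 0 -> 0 < dotv v (A *m v).

(* [is_trig_mx] means lower triangular; positivity of the diagonal is the usual
   normalisation that makes the factor unique. *)
Definition is_cholesky {R : realType} {n : nat} (L A : 'M[R]_n) : Prop :=
  [/\ is_trig_mx L, forall i, 0 < L i i & L *m L^T = A].

(* The univariate law N(m, s^2). The degenerate law N(m, 0) is the Dirac mass
   at m; it has to be treated apart since the library gives the junk value
   uniform on [0, 1] to [normal_prob m 0]. *)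
Definition gaussian_law {R : realType} (m s : R) :
    set (measurableTypeR R) -> \bar R :=
  if s == 0 then dirac (m : measurableTypeR R) else normal_prob m s.

Section gaussian_vector.
Context d (T : measurableType d) (R : realType) (P : probability T R).

Definition is_gaussian (Y : T -> R) : Prop :=
  exists m s : R, 0 <= s /\
    forall A : set (measurableTypeR R), measurable A ->
      P (Y @^-1` A) = gaussian_law m s A.

(* A random vector in R^n is given by its n real random components. *)
Definition rvect n (xi : 'I_n -> {RV P >-> R}) (w : T) : 'cV[R]_n :=
  \col_i xi i w.

(* xi ~ N(mu, Sigma): the components are jointly Gaussian, i.e. all their linear
   combinations are univariate Gaussian, the mean vector of xi is mu and its
   covariance matrix is Sigma. *)
Definition is_gaussian_vector n (xi : 'I_n -> {RV P >-> R})
    (mu : 'cV[R]_n) (Sigma : 'M[R]_n) : Prop :=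
  [/\ forall x : 'cV[R]_n, is_gaussian (fun w => dotv x (rvect xi w)),
      forall i, ('E_P[xi i] = (mu i 0)%:E)%E
    & forall i j, covariance P (xi i) (xi j) = (Sigma i j)%:E].

End gaussian_vector.

(* |F z + u|_2 <= g z + c with F, g linear; when F = 0 and u = 0 this is an
   affine inequality. *)
Definition is_soc_constraint {R : realType} {V : lmodType R} (C : set V) :
    Prop :=
  exists (k : nat) (F : {linear V -> 'cV[R]_k}) (u : 'cV[R]_k)
         (g : {linear V -> R^o}) (c : R),
    C = [set z : V | l2norm (F z + u) <= g z + c].

Definition is_soc_set {R : realType} {V : lmodType R} (S : set V) : Prop :=
  exists (m : nat) (C : 'I_m -> set V),
    (forall i, is_soc_constraint (C i)) /\ S = \bigcap_i C i.

Definition soc_system {R : realType} {n : nat} (mu : 'cV[R]_n) (L : 'M[R]_n)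
    (eps : R) (a b : R) (x : 'cV[R]_n) (t : R) : Prop :=
  [/\ l2norm (L^T *m x) <= t,
      a - dotv mu x <= Phi_inv eps * t,
      b - dotv mu x >= Phi_inv (1 - eps) * t
    & a - b <= 2 * Phi_inv (eps / 2) * t].

(* R^o is R viewed as a module over itself. *)
Definition soc_feasible_set {R : realType} {n : nat} (mu : 'cV[R]_n)
    (L : 'M[R]_n) (eps : R) : set (R^o * R^o * 'cV[R]_n * R^o) :=
  [set z | soc_system mu L eps z.1.1.1 z.1.1.2 z.1.2 z.2].

(* Main.v *)
Require Import Defs.
From HB Require Import structures.
From mathcomp Require Import all_boot all_order all_algebra.
From mathcomp Require Import all_classical all_reals all_analysis.
From mathcomp Require Import measurable_realfun ring lra.

(**
  Write [Q = 1 - Phi] for the Gaussian tail. The random variable [x^T xi] has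
  law N(m, s^2) with [m = mu^T x] and [s = |L^T x|_2], so after standardisation
  everything is about [Phi b - Phi a], with [t = s] the best choice of [t].

  Outer approximation: the first two inequalities bound each one-sided tail
  by [eps]; the third one holds because, among the intervals of given length,
  the one centred at the mean has the largest mass.

  Approximation guarantee: put [q = Phi_inv (1 - eps)] and
  [r = - Phi_inv (eps / 2)]. The system gives [u := -a >= q], [b >= q] and
  [u + b >= 2 r]; as [Q] is convex and decreasing on the positive half-line,
  [Q u + Q b <= Q q + Q (2 r - q)]. Since [Q] is log-concave,
  [Q q * Q (2 r - q) <= (Q r)^2], that is, [eps * Q (2 r - q) <= eps^2 / 4],
  whence [Q u + Q b <= eps + eps / 4].

  The extremality of centred intervals, the convexity and the log-concavity
  all come from comparing the masses of an interval and of its translate by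
  [d], given that [phi (y + d) / phi y = exp (- d y - d^2 / 2)] is monotone
  in [y].
*)

Set Implicit Arguments.
Unset Strict Implicit.
Unset Printing Implicit Defensive.

Import Order.TTheory GRing.Theory Num.Theory.
Import numFieldNormedType.Exports.

Local Open Scope classical_set_scope.
Local Open Scope ring_scope.

(** * The standard normal distribution function *)

Section standard_normal.
Context {R : realType}.
Implicit Types x y z a b d c p : R.
Local Notation phi := (@normal_pdf R 0 1).

Lemma normal_pdf01E x :
  phi x = normal_peak 1 * expR (- (x ^+ 2 / 2)).
Proof.
by rewrite normal_pdfE ?oner_eq0// /normal_fun subr0 expr1n mulNr.
Qed.

Lemma normal_pdf01_gt0 x : 0 < phi x.
Proof. by rewrite normal_pdf01E mulr_gt0 ?expR_gt0// normal_peak_gt0 ?oner_eq0. Qed.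

Lemma normal_pdf01N x : phi (- x) = phi x.
Proof. by rewrite !normal_pdf01E sqrrN. Qed.

Lemma normal_pdf01D x d : phi (x + d) = expR (- (d * x) - d ^+ 2 / 2) * phi x.
Proof.
rewrite !normal_pdf01E mulrCA -expRD; congr (_ * expR _).
by field.
Qed.

Lemma is_derive_Phi x : is_derive x 1 Phi (phi x).
Proof.
have int01 : lebesgue_measure.-integrable [set: R] (EFin \o phi).
  exact: integrable_normal_pdf.
(* The fundamental theorem of calculus is applied on a ray reaching strictly beyond [x]; the bound
   [x + 1] is arbitrary. *)
have xx1 : x < x + 1 by rewrite ltrDl.
have [|||h1 h2] := @continuous_FTC1 R phi -oo%O x _ xx1.
- exact: integrableS int01.
- by rewrite ltNyr.
- by apply: continuous_normal_pdf; rewrite oner_eq0.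
by split; rewrite -?derive1E.
Qed.

Lemma derivable_Phi x : derivable Phi x 1.
Proof. by case: (is_derive_Phi x). Qed.

Lemma derive1_Phi : derive1 Phi = phi.
Proof.
by apply/funext => x; rewrite derive1E; case: (is_derive_Phi x).
Qed.

Lemma continuous_Phi : continuous (@Phi R).
Proof.
by move=> x; apply/differentiable_continuous/derivable1_diffP/derivable_Phi.
Qed.

Lemma Phi_lt : {mono @Phi R : x y / x < y}.
Proof.
apply: leW_mono; apply: le_mono => x y xy.
apply: (@gtr0_derive1_incr _ (@Phi R) x y) => //.
- by move=> z _; exact: derivable_Phi.
- by move=> z _; rewrite derive1_Phi normal_pdf01_gt0.
- exact/continuous_subspaceT/continuous_Phi.
Qed.

Lemma Phi_le : {mono @Phi R : x y / x <= y}.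
Proof.
by apply: le_mono => x y; rewrite Phi_lt.
Qed.

Lemma PhiE x : (Phi x)%:E = normal_prob 0 1 `]-oo, x].
Proof. by rewrite fineK// fin_num_measure. Qed.

(** Seen as a random variable under [normal_prob 0 1], the identity has [Phi] as its distribution
    function, whence the limits of [Phi] at both infinities. *)
Let idR : measurableTypeR R -> R := idfun.

#[local] HB.instance Definition _ :=
  @isMeasurableFun.Build _ _ _ _ idR (@measurable_id _ _ setT).

Lemma cvg_PhiNy : @Phi R @ -oo --> (0 : R).
Proof.
exact/fine_cvg/(@cvg_cdfNy0 _ _ _ (normal_prob 0 1) idR).
Qed.

Lemma cvg_Phiy : @Phi R @ +oo --> (1 : R).
Proof.
exact/fine_cvg/(@cvg_cdfy1 _ _ _ (normal_prob 0 1) idR).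
Qed.

Lemma normal_prob_rayl (m s a : R) :
  normal_prob m s `]-oo, a[ = normal_prob m s `]-oo, a].
Proof.
rewrite /normal_prob integral_itv_bndo_bndc//.
have mpdf : measurable_fun [set: R] (EFin \o normal_pdf m s).
  by apply/measurable_EFinP; exact: measurable_normal_pdf.
exact: measurable_funTS mpdf.
Qed.

Lemma PhiN x : Phi (- x) = 1 - Phi x.
Proof.
(* Dropping the endpoint, which has no mass, makes the complement the closed ray [[x, +oo[]; the
   reflection z -> -z carries it to []-oo, -x]], and [phi] is even. *)
apply: EFin_inj; rewrite EFinB !PhiE -(normal_prob_rayl _ _ x).
rewrite -probability_setC// setCitvl.
have cphi : {within `]-oo, - x], continuous phi}.
  by apply/continuous_subspaceT/continuous_normal_pdf; rewrite oner_eq0.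
have phi0 : {in `]-oo, - x[, forall z, 0 <= phi z}.
  by move=> z _; exact/ltW/normal_pdf01_gt0.
rewrite /normal_prob (ge0_integration_by_substitutionNy cphi phi0).
by apply: eq_integral => z _; rewrite /comp normal_pdf01N.
Qed.

(** The limits 0 and 1 give values of [Phi] on both sides of [p]; the intermediate value theorem
    does the rest. *)
Lemma Phi_surj p : 0 < p < 1 -> exists x, Phi x = p.
Proof.
move=> /andP[p0 p1].
have [a ap] : exists a, Phi a < p.
  have /cvgrPdist_lt/(_ _ p0) := cvg_PhiNy.
  move=> [M [_ /(_ (M - 1))]]; rewrite ltrBlDr ltrDl => /(_ ltr01).
  rewrite sub0r normrN => /(le_lt_trans (ler_norm _)); by exists (M - 1).
have [b pb] : exists b, p < Phi b.
  have p1' : 0 < 1 - p by rewrite subr_gt0.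
  have /cvgrPdist_lt/(_ _ p1') := cvg_Phiy.
  move=> [M [_ /(_ (M + 1))]]; rewrite ltrDl => /(_ ltr01).
  move=> /(le_lt_trans (ler_norm _)); rewrite ltrD2l ltrN2; by exists (M + 1).
have ab : a <= b by rewrite -Phi_le ltW// (lt_trans ap).
have [||c _ <-] := @IVT R (@Phi R) a b p ab; last by exists c.
- exact/continuous_subspaceT/continuous_Phi.
- by rewrite ge_min le_max (ltW ap) (ltW pb) orbT.
Qed.

Lemma Phi_invK p : 0 < p < 1 -> Phi (Phi_inv p) = p.
Proof.
move=> /Phi_surj[x xp]; rewrite /Phi_inv pinvK// inE.
by exists x.
Qed.

Lemma Phi_ge0 x : 0 <= Phi x.
Proof. by rewrite fine_ge0. Qed.

Lemma Phi0 : Phi 0 = 1 / 2 :> R.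
Proof. by have := PhiN 0; rewrite oppr0 => h; lra. Qed.

(** * Comparing an interval with its translate *)

Lemma is_derive_Phi_shift x d : is_derive x 1 (fun y => Phi (y + d)) (phi (x + d)).
Proof.
rewrite -[phi _]mulr1.
apply: (@is_derive1_comp _ (@Phi R) (fun y => y + d)).
  exact: is_derive_Phi.
exact: is_derive_shift.
Qed.

(** The derivative of [K * Phi y - Phi (y + d)] is nonnegative on [a, b]. *)
Lemma Phi_itv_shift_le a b d K : a <= b ->
  (forall y, a <= y <= b -> phi (y + d) <= K * phi y) ->
  Phi (b + d) - Phi (a + d) <= K * (Phi b - Phi a).
Proof.
move=> ab H; rewrite -subr_ge0.
pose f y := K * Phi y - Phi (y + d).
have df y : is_derive y 1 f (K * phi y - phi (y + d)).
  apply: is_deriveB; last exact: is_derive_Phi_shift.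
  apply: is_deriveZ; exact: is_derive_Phi.
suff : f a <= f b by rewrite /f => ?; lra.
apply: (@ger0_derive1_ndecr _ f a b) => //.
- by move=> y; rewrite in_itv/= => /andP[ay yb]; rewrite derive1E derive_val subr_ge0 H// !ltW.
- apply: continuous_subspaceT => y.
  by apply/differentiable_continuous/derivable1_diffP; case: (df y).
Qed.

Lemma Phi_itv_shift_ge a b d K : a <= b ->
  (forall y, a <= y <= b -> K * phi y <= phi (y + d)) ->
  K * (Phi b - Phi a) <= Phi (b + d) - Phi (a + d).
Proof.
move=> ab H; rewrite -subr_ge0.
pose f y := Phi (y + d) - K * Phi y.
have df y : is_derive y 1 f (phi (y + d) - K * phi y).
  apply: is_deriveB; first exact: is_derive_Phi_shift.
  apply: is_deriveZ; exact: is_derive_Phi.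
suff : f a <= f b by rewrite /f => ?; lra.
apply: (@ger0_derive1_ndecr _ f a b) => //.
- by move=> y; rewrite in_itv/= => /andP[ay yb]; rewrite derive1E derive_val subr_ge0 H// !ltW.
- apply: continuous_subspaceT => y.
  by apply/differentiable_continuous/derivable1_diffP; case: (df y).
Qed.

(** This is the interval comparison in the limit where the right end tends to [+oo]. *)
Lemma Phi_tail_shift_le a d K :
  (forall y, a <= y -> phi (y + d) <= K * phi y) ->
  1 - Phi (a + d) <= K * (1 - Phi a).
Proof.
move=> H.
have c1 : Phi (b + d) - Phi (a + d) @[b --> +oo] --> 1 - Phi (a + d).
  apply: cvgB; last exact: cvg_cst.
  by apply: cvg_comp cvg_Phiy; exact: cvg_addrr.
have c2 : K * (Phi b - Phi a) @[b --> +oo] --> K * (1 - Phi a).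
  apply: cvgMr; apply: cvgB; last exact: cvg_cst.
  exact: cvg_Phiy.
apply: (ler_cvg_to c1 c2).
near=> b; apply: Phi_itv_shift_le => [|y /andP[]]; last by move=> /H.
by near: b; apply: nbhs_pinfty_ge; rewrite num_real.
Unshelve. all: by end_near. Qed.

(** By reflection the midpoint may be taken nonnegative. With h = (b - a) / 2, passing from [-h, h]
    to [a, b] trades the mass of [-h, a] for that of its translate [h, b], where the density is no
    larger. *)
Lemma Phi_itv_le_centered a b : a <= b -> Phi b - Phi a <= 2 * Phi ((b - a) / 2) - 1.
Proof.
wlog m0 : a b / 0 <= a + b.
  move=> H ab; have [|ab0] := leP 0 (a + b); first by move=> /H; exact.
  have := H (- b) (- a); rewrite !PhiN.
  have -> : - a - - b = b - a by ring.
  by move=> h; have := h ltac:(lra) ltac:(lra); lra.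
move=> ab.
have := @Phi_itv_shift_le (- ((b - a) / 2)) a (b - a) 1 ltac:(lra) .
rewrite mul1r PhiN.
have -> : a + (b - a) = b by ring.
have -> : - ((b - a) / 2) + (b - a) = (b - a) / 2 by field.
move=> h; suff : Phi b - Phi ((b - a) / 2) <= Phi a - (1 - Phi ((b - a) / 2)) by lra.
apply: h => y /andP[hy _]; rewrite mul1r normal_pdf01D ler_piMl//.
  exact/ltW/normal_pdf01_gt0.
rewrite -[leRHS]expR0 ler_expR.
have : 0 <= (b - a) * (y + (b - a) / 2) by apply: mulr_ge0; lra.
by lra.
Qed.

(** The interval [v, u + v - q] is the translate of [q, u] by v - q >= 0, and [phi] decreases on the
    positive half-line. *)
Lemma Phi_tail_convex (q u v : R) : 0 <= q -> q <= u -> q <= v ->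
  (1 - Phi u) + (1 - Phi v) <= (1 - Phi q) + (1 - Phi (u + v - q)).
Proof.
move=> q0 qu qv.
have := @Phi_itv_shift_le q u (v - q) 1 qu.
rewrite mul1r addrA [q + _]addrC subrK.
move=> h; suff : Phi (u + v - q) - Phi v <= Phi u - Phi q by lra.
apply: h => y /andP[hy _]; rewrite mul1r normal_pdf01D ler_piMl//.
  exact/ltW/normal_pdf01_gt0.
rewrite -[leRHS]expR0 ler_expR.
have : 0 <= (v - q) * (y + (v - q) / 2) by apply: mulr_ge0; lra.
by lra.
Qed.

(** The ratio phi (y + d) / phi y is nonincreasing in y, with value [K] at [r]: translation by [d]
    multiplies the mass of [r - d, r] by at least [K] and the tail beyond [r] by at most [K]. *)
Lemma Phi_tail_logconcave (r d : R) : 0 <= d ->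
  (1 - Phi (r - d)) * (1 - Phi (r + d)) <= (1 - Phi r) ^+ 2.
Proof.
move=> d0; pose K := expR (- (d * r) - d ^+ 2 / 2).
have hA : K * (Phi r - Phi (r - d)) <= Phi (r + d) - Phi r.
  have := @Phi_itv_shift_ge (r - d) r d K ltac:(lra); rewrite subrK; apply.
  move=> y /andP[_ yr]; rewrite normal_pdf01D ler_pM2r ?normal_pdf01_gt0//.
  by rewrite /K ler_expR; nra.
have hB : 1 - Phi (r + d) <= K * (1 - Phi r).
  apply: Phi_tail_shift_le => y yr; rewrite normal_pdf01D.
  by rewrite ler_pM2r ?normal_pdf01_gt0// /K ler_expR; nra.
have Ql x : 0 <= 1 - Phi x by rewrite -PhiN Phi_ge0.
have A0 : 0 <= Phi r - Phi (r - d) by rewrite subr_ge0 Phi_le; lra.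
have := Ql r; have := Ql (r + d).
move: hA hB A0; set A := Phi r; set B := Phi (r + d); set C := Phi (r - d).
move=> hA hB A0 QB QA.
(* Eliminating [K] gives (A - C)(1 - B) <= (B - A)(1 - A); adding (1 - A)(1 - B) to both sides
   yields the claim. *)
have : (A - C) * (1 - B) <= (A - C) * (K * (1 - A)) by rewrite ler_wpM2l.
have : K * (A - C) * (1 - A) <= (B - A) * (1 - A) by rewrite ler_wpM2r.
nra.
Qed.

End standard_normal.

(** * Laws N(m, s^2) *)

Section normal_law.
Context {R : realType}.
Implicit Types (x y z m s : R) (f : R -> R).
Notation mu := (@lebesgue_measure R).
Local Notation phi := (@normal_pdf R 0 1).

Lemma normal_pdf_affine m s z : 0 < s -> normal_pdf m s (m + s * z) * s = phi z.
Proof.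
move=> s0; rewrite normal_pdfE ?gt_eqF// normal_pdfE ?oner_eq0//.
rewrite /normal_fun /normal_peak !expr1n mul1r subr0 addrAC subrr add0r.
have -> : - (s * z) ^+ 2 / (s ^+ 2 *+ 2) = - z ^+ 2 / (1 *+ 2).
  by field; rewrite gt_eqF.
rewrite mulrAC; congr (_ * _).
rewrite -mulrnAr sqrtrM ?sqr_ge0// sqrtr_sqr gtr0_norm// invfM mulrAC mulVf ?gt_eqF//.
by rewrite mul1r.
Qed.

Lemma derive1_affine m s : derive1 (fun z : R => m + s * z) = cst s.
Proof.
apply/funext => z; rewrite derive1E.
by rewrite deriveD// derive_cst add0r deriveM// derive_cst scaler0 addr0 derive_id scaler1.
Qed.

Lemma derivable_affine m s z : derivable (fun z : R => m + s * z) z 1.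
Proof. by []. Qed.

Lemma cvg_affineNy m s : 0 < s -> m + s * z @[z --> -oo] --> -oo.
Proof.
move=> s0; have -> : (fun z => m + s * z) = +%R^~ m \o *%R^~ s.
  by apply/funext => z /=; rewrite addrC mulrC.
apply: cvg_comp (cvg_addrr_Ny _).
exact: (gt0_cvgMlNy s0 cvg_id).
Qed.

Lemma cvg_affiney m s : 0 < s -> m + s * z @[z --> +oo] --> +oo.
Proof.
move=> s0; have -> : (fun z => m + s * z) = +%R^~ m \o *%R^~ s.
  by apply/funext => z /=; rewrite addrC mulrC.
apply: cvg_comp (cvg_addrr _).
exact: (gt0_cvgMly s0 cvg_id).
Qed.

Lemma normal_prob_rayr m s y : 0 < s ->
  normal_prob m s `]-oo, y] = (Phi ((y - m) / s))%:E.
Proof.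
move=> s0; rewrite PhiE /normal_prob.
pose F z := m + s * z.
have Fb : F ((y - m) / s) = y by rewrite /F; field; rewrite gt_eqF.
rewrite -{1}Fb.
have F' : derive1 F = cst s by exact: derive1_affine.
rewrite (@increasing_ge0_integration_by_substitutionNy _ F (normal_pdf m s)).
- by apply: eq_integral => z _; rewrite F' -(normal_pdf_affine m z s0).
- by move=> a b _ _ ab; rewrite /F ltrD2l ltr_pM2l.
- by move=> z _; rewrite F'; exact: cst_continuous.
- by rewrite F'; exact: is_cvg_cst.
- by rewrite F'; exact: cvg_cst.
- split; first by move=> *; exact: derivable_affine.
  apply: cvg_at_left_filter; apply/differentiable_continuous/derivable1_diffP.
  exact: derivable_affine.
- exact: cvg_affineNy.
- by apply: continuous_subspaceT; apply: continuous_normal_pdf; rewrite gt_eqF.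
- by move=> z _; exact: normal_pdf_ge0.
Qed.

(** The Radon-Nikodym derivative and [normal_pdf] have the same integral over every measurable set,
    so they agree almost everywhere. *)
Lemma ge0_integral_normal_prob_pdf m s (f : R -> \bar R) :
  measurable_fun [set: R] f -> (forall x, 0 <= f x)%E ->
  (\int[normal_prob m s]_x f x = \int[mu]_x (f x * (normal_pdf m s x)%:E))%E.
Proof.
move=> mf f0.
have dom := normal_prob_dominates m s.
rewrite -(Radon_Nikodym_SigmaFinite.change_of_variables dom f0 measurableT mf).
have mpdf : measurable_fun [set: R] (EFin \o normal_pdf m s).
  by apply/measurable_EFinP; exact: measurable_normal_pdf.
have ig := Radon_Nikodym_SigmaFinite.f_integrable dom.
apply: ae_eq_integral => //.
- apply: emeasurable_funM => //; exact: measurable_int ig.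
- exact: emeasurable_funM.
- apply: ae_eqe_mul2l.
  apply: integral_ae_eq => //.
  by move=> E _ mE; rewrite -(Radon_Nikodym_SigmaFinite.f_integral dom).
Qed.

Lemma ge0_integral_normal_prob m s f : 0 < s -> continuous f ->
  (forall x, 0 <= f x) ->
  (\int[normal_prob m s]_x (f x)%:E =
   \int[mu]_z (f (m + s * z)%R * phi z)%:E)%E.
Proof.
move=> s0 cf f0; rewrite ge0_integral_normal_prob_pdf; last 2 first.
- by apply/measurable_EFinP; exact: continuous_measurable_fun.
- by move=> x; rewrite lee_fin.
pose F z := m + s * z.
have F' : derive1 F = cst s by exact: derive1_affine.
under eq_integral do rewrite -EFinM.
rewrite (@increasing_ge0_integration_by_substitutionT _ F (fun x => f x * normal_pdf m s x)).
- by apply: eq_integral => z _; rewrite F' -(normal_pdf_affine m z s0) mulrA.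
- by move=> a b ab; rewrite /F ltrD2l ltr_pM2l.
- by rewrite F' => z; exact: cst_continuous.
- by rewrite F'; exact: is_cvg_cst.
- by rewrite F'; exact: is_cvg_cst.
- by move=> z; exact: derivable_affine.
- exact: cvg_affineNy.
- exact: cvg_affiney.
- move=> z; apply: cvgM; first exact: cf.
  by apply: continuous_normal_pdf; rewrite gt_eqF.
- by move=> z; rewrite mulr_ge0// normal_pdf_ge0.
Qed.

End normal_law.

(** * Second moment and symmetry of the standard normal density *)

Section normal_moments.
Context {R : realType}.
Implicit Types (x y z m s : R) (f : R -> R).
Notation mu := (@lebesgue_measure R).
Local Notation phi := (@normal_pdf R 0 1).

Lemma is_derive_normal_pdf01 z : is_derive z 1 phi (- (z * phi z)).
Proof.
have -> : phi = fun x => normal_peak 1 * expR (- (x ^+ 2 / 2)).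
  by apply/funext => x; exact: normal_pdf01E.
apply: is_derive_eq.
by rewrite /GRing.scale/=; field.
Qed.

Lemma cvg_mul_normal_pdf01 : z * phi z @[z --> +oo] --> (0 : R).
Proof.
apply/cvgrPdist_lt => e e0; near=> z.
have z0 : 0 < z by near: z; apply: nbhs_pinfty_gt; rewrite num_real.
(* Since exp (z^2 / 2) >= z^2 / 2, the product z * phi z is at most 2 * normal_peak 1 / z; this
   threshold brings it below [e]. *)
have ze : 2 * normal_peak 1 / e < z.
  by near: z; apply: nbhs_pinfty_gt; rewrite num_real.
have p0 : 0 < normal_peak (1 : R) by rewrite normal_peak_gt0// oner_eq0.
rewrite sub0r normrN gtr0_norm ?mulr_gt0 ?normal_pdf01_gt0//.
rewrite normal_pdf01E expRN.
have h : 0 < z ^+ 2 / 2 by rewrite divr_gt0 ?exprn_gt0.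
apply: (@le_lt_trans _ _ (z * (normal_peak 1 * (z ^+ 2 / 2)^-1))).
  rewrite ler_pM2l// ler_pM2l// lef_pV2 ?posrE ?expR_gt0//.
  by rewrite (le_trans _ (expR_ge1Dx _))// lerDr.
have -> : z * (normal_peak 1 * (z ^+ 2 / 2)^-1) = 2 * normal_peak 1 / z.
  by field; rewrite gt_eqF.
by rewrite ltr_pdivrMr// [e * z]mulrC -ltr_pdivrMr.
Unshelve. all: by end_near. Qed.

Lemma integral_sqr_normal_pdf01 : (\int[mu]_z (z ^+ 2 * phi z)%:E = 1)%E.
Proof.
have cphi : continuous phi by apply: continuous_normal_pdf; rewrite oner_eq0.
have csq : continuous (fun z => z ^+ 2 * phi z).
  by move=> z; apply: cvgM; [exact: exprn_continuous|exact: cphi].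
rewrite ge0_symfun_integralT//; last 2 first.
- by move=> z; rewrite mulr_ge0 ?sqr_ge0// normal_pdf_ge0.
- by move=> z /=; rewrite sqrrN normal_pdf01N.
(* An antiderivative, by phi' z = - z * phi z. It rises from 1/2 at 0 to 1 at infinity, and evenness
   doubles the difference. *)
pose G z := Phi z - z * phi z.
have dG z : is_derive z 1 G (z ^+ 2 * phi z).
  have := is_derive_normal_pdf01 z; have := is_derive_Phi z => h1 h2.
  apply: is_derive_eq; rewrite /GRing.scale/=; ring.
have -> : [set x : R | 0 <= x] = `[0, +oo[%classic.
  by apply/seteqP; split => x /=; rewrite in_itv/= andbT.
rewrite (@ge0_continuous_FTC2y _ _ G 0 1).
- by rewrite /G mul0r subr0 Phi0 -EFinB -EFinM; congr EFin; field.
- by move=> z _; rewrite mulr_ge0 ?sqr_ge0// normal_pdf_ge0.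
- exact: continuous_subspaceT.
- rewrite -[X in _ --> X]subr0; apply: cvgB; first exact: cvg_Phiy.
  exact: cvg_mul_normal_pdf01.
- by move=> z _; case: (dG z).
- apply: cvg_at_right_filter; apply/differentiable_continuous/derivable1_diffP.
  by case: (dG 0).
- by move=> z _; rewrite derive1E derive_val.
Qed.

Lemma continuous_max0 : continuous (fun x => Num.max x 0).
Proof.
under eq_fun do rewrite maxr_absE addr0 subr0.
move=> x; apply: cvgMl; apply: cvgD; first exact: cvg_id.
exact: norm_continuous.
Qed.

(** As s >= 0, the left integrand vanishes for z < 0 and the right one for z > 0; the reflection z
    -> -z exchanges them. *)
Lemma integral_max0_normal_pdf01 s : 0 <= s ->
  (\int[mu]_z (Num.max (s * z) 0 * phi z)%:E =
   \int[mu]_z (Num.max (- (s * z)) 0 * phi z)%:E)%E.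
Proof.
move=> s0; have cphi : continuous phi by apply: continuous_normal_pdf; rewrite oner_eq0.
pose g z := Num.max (- (s * z)) 0 * phi z.
have cg : continuous g.
  move=> z; apply: cvgM; last exact: cphi.
  apply: (continuous_comp (f := fun z => - (s * z)) (g := fun x => Num.max x 0));
    last exact: continuous_max0.
  by apply: cvgN; apply: cvgMr; exact: cvg_id.
have g0 z : 0 <= g z by rewrite mulr_ge0 ?normal_pdf_ge0// le_max lexx orbT.
transitivity (\int[mu]_(z in `[0%R, +oo[) (g (- z))%:E)%E.
  rewrite [RHS]integral_mkcond; apply: eq_integral => z _; rewrite patchE.
  rewrite mem_setE in_itv/= andbT /g mulrN opprK normal_pdf01N.
  case: ifPn => //; rewrite -ltNge => z0.
  by rewrite max_r ?mul0r// mulr_ge0_le0// ltW.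
transitivity (\int[mu]_(z in `]-oo, 0%R]) (g z)%:E)%E.
  have cg0 : {within `]-oo, (- 0)], continuous g} by exact: continuous_subspaceT.
  have := ge0_integration_by_substitutionNy cg0 (fun z _ => g0 z).
  by rewrite oppr0 => ->.
rewrite integral_mkcond; apply: eq_integral => z _; rewrite patchE.
rewrite mem_setE in_itv/= /g.
case: ifPn => //; rewrite -ltNge => z0.
by rewrite max_r ?mul0r// oppr_le0 mulr_ge0// ltW.
Qed.

End normal_moments.

(** * Gaussian vectors *)

Section gaussian_rv.
Context d (T : measurableType d) (R : realType) (P : probability T R).
Implicit Types (x y z m s : R) (f : R -> R) (X Y : T -> R).
Notation mu := (@lebesgue_measure R).
Local Notation phi := (@normal_pdf R 0 1).

Definition has_law (Y : T -> R) (nu : set (measurableTypeR R) -> \bar R) :=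
  forall A : set (measurableTypeR R), measurable A -> P (Y @^-1` A) = nu A.

(** The parametrisation m + s z also covers s = 0: the right side is then [f m] times the total mass
    1 of [phi], which is the Dirac integral. *)
Lemma ge0_integral_gaussian_law Y m s f : measurable_fun [set: T] Y ->
  0 <= s -> has_law Y (gaussian_law m s) -> continuous f ->
  (forall x, 0 <= f x) ->
  (\int[P]_w (f (Y w))%:E = \int[mu]_z (f (m + s * z)%R * phi z)%:E)%E.
Proof.
move=> mY s0 lawY cf f0.
have mf : measurable_fun [set: R] (EFin \o f).
  by apply/measurable_EFinP; exact: continuous_measurable_fun.
pose YR : T -> measurableTypeR R := Y.
have mYR : measurable_fun [set: T] YR by exact: mY.
have -> : (\int[P]_w (f (Y w))%:E = \int[pushforward P YR]_y (f y)%:E)%E.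
  rewrite ge0_integral_pushforward//.
  by move=> y _; rewrite lee_fin.
move: lawY; rewrite /has_law /gaussian_law; case: eqVneq => [->|sn0] lawY.
  rewrite (eq_measure_integral (dirac (m : measurableTypeR R))); last first.
    by move=> A mA _; exact: lawY.
  rewrite integral_dirac// diracT mul1e.
  under [RHS]eq_integral do rewrite mul0r addr0 EFinM.
  rewrite integralZl//; last exact: integrable_normal_pdf.
  by rewrite integral_normal_pdf mule1.
rewrite (eq_measure_integral (normal_prob m s)); last first.
  by move=> A mA _; exact: lawY.
by rewrite ge0_integral_normal_prob// lt_neqAle eq_sym sn0.
Qed.

(* The law is symmetric about m, so the positive and negative parts of Y - m
   have the same integral. *)
Lemma gaussian_law_mean Y m s : Y \in Lfun P 1 ->
  0 <= s -> has_law Y (gaussian_law m s) -> ('E_P[Y] = m%:E)%E.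
Proof.
move=> Y1 s0 lawY.
have mY : measurable_fun [set: T] Y.
  by move: Y1; rewrite inE => /andP[]; rewrite inE.
have Ym1 : Y \- cst m \in Lfun P 1 by rewrite rpredB// Lfun_cst.
have iYm : P.-integrable [set: T] (EFin \o (Y \- cst m)).
  exact/Lfun1_integrable.
(* Taking c = 1 and c = -1 gives the positive and negative parts of Y - m. *)
have Emax c : (\int[P]_w (Num.max (c * (Y w - m)) 0)%:E =
    \int[mu]_z (Num.max (c * (s * z)) 0 * phi z)%:E)%E.
  rewrite (ge0_integral_gaussian_law (f := fun x => Num.max (c * (x - m)) 0)
    mY s0 lawY).
  - by apply: eq_integral => z _; rewrite [m + _]addrC addrK.
  - move=> x; apply: (continuous_comp (f := fun x => c * (x - m))
        (g := fun x => Num.max x 0)); last exact: continuous_max0.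
    by apply: cvgMr; apply: cvgB; [exact: cvg_id|exact: cvg_cst].
  - by move=> x; rewrite le_max lexx orbT.
have Ep : (\int[P]_w ((EFin \o (Y \- cst m)%R)^\+ w) =
    \int[mu]_z (Num.max (s * z)%R 0 * phi z)%:E)%E.
  have := Emax 1; under [RHS]eq_integral do rewrite mul1r; move=> <-.
  by apply: eq_integral => w _; rewrite funeposE /= EFin_max mul1r.
have En : (\int[P]_w ((EFin \o (Y \- cst m)%R)^\- w) =
    \int[mu]_z (Num.max (- (s * z))%R 0 * phi z)%:E)%E.
  have := Emax (-1); under [RHS]eq_integral do rewrite mulN1r; move=> <-.
  by apply: eq_integral => w _; rewrite funenegE /= EFin_max mulN1r.
have : ('E_P[Y \- cst m] = 0)%E.
  rewrite unlock integralE Ep En integral_max0_normal_pdf01// subee//.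
  by rewrite -integral_max0_normal_pdf01// -Ep; exact: integrable_pos_fin_num.
rewrite expectationB ?Lfun_cst// expectation_cst.
rewrite -(fineK (expectation_fin_num Y1)) -EFinB => -[].
by move=> /subr0_eq ->.
Qed.

Lemma gaussian_law_variance Y m s : Y \in Lfun P 1 ->
  0 <= s -> has_law Y (gaussian_law m s) -> covariance P Y Y = (s ^+ 2)%:E.
Proof.
move=> Y1 s0 lawY.
have mY : measurable_fun [set: T] Y.
  by move: Y1; rewrite inE => /andP[]; rewrite inE.
rewrite unlock (gaussian_law_mean Y1 s0 lawY) unlock.
have h := (ge0_integral_gaussian_law (f := fun x => (x - m) ^+ 2) mY s0 lawY).
rewrite [LHS]h.
- have e z : (m + s * z - m) ^+ 2 * phi z = s ^+ 2 * (z ^+ 2 * phi z) by ring.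
  under eq_integral do rewrite e EFinM.
  rewrite ge0_integralZl//.
  + by rewrite integral_sqr_normal_pdf01 mule1.
  + apply/measurable_EFinP; apply: measurable_funM.
      exact: measurable_funX.
    exact: measurable_normal_pdf.
  + by move=> z _; rewrite lee_fin mulr_ge0 ?sqr_ge0// normal_pdf_ge0.
  + by rewrite lee_fin sqr_ge0.
- move=> x; apply: (@continuous_comp _ _ _ (fun x => x - m) (fun x => x ^+ 2)).
    by apply: cvgB; [exact: cvg_id|exact: cvg_cst].
  exact: exprn_continuous.
- by move=> x; exact: sqr_ge0.
Qed.

Lemma expectation_sumr (I : Type) (r : seq I) (X : I -> T -> R) :
  (forall i, X i \in Lfun P 1) ->
  ('E_P[\sum_(i <- r) X i] = \sum_(i <- r) 'E_P[X i])%E.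
Proof.
move=> X1; elim: r => [|i r IH]; first by rewrite !big_nil expectation_cst.
by rewrite !big_cons expectationD ?IH// rpred_sum.
Qed.

Lemma covariance_suml (I : Type) (r : seq I) (X : I -> T -> R) Y :
  (forall i, X i \in Lfun P 2%:E) -> Y \in Lfun P 2%:E ->
  (covariance P (\sum_(i <- r) X i) Y = \sum_(i <- r) covariance P (X i) Y)%E.
Proof.
move=> X2 Y2; elim: r => [|i r IH]; first by rewrite !big_nil covariance_cst_l.
by rewrite !big_cons covarianceDl ?IH// rpred_sum// lee1n.
Qed.

(** Here [covariance P X X] is the integral of the nonnegative function (X - c)^2, so its finiteness
    puts X - c in L^2, and then also X. *)
Lemma covariance_Lfun2 X c :
  measurable_fun [set: T] X -> ('E_P[X] = c%:E)%E ->
  (covariance P X X < +oo)%E -> X \in Lfun P 2%:E.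
Proof.
move=> mX EX; rewrite unlock EX unlock => h.
have -> : X = (X \- cst c) \+ cst c by apply/funext => w /=; rewrite subrK.
rewrite rpredD ?lee1n//= => _; last exact: Lfun_cst.
rewrite inE; apply/andP; split; rewrite inE/=.
  exact: measurable_funB.
rewrite /finite_norm unlock poweR_lty//.
rewrite (eq_integral (fun w => ((X w - c) ^+ 2)%:E))// => w _ /=.
by rewrite powR_mulrn// real_normK// num_real.
Qed.

End gaussian_rv.

(** * Linear combinations of a Gaussian vector *)

Section gaussian_vector.
Context d (T : measurableType d) (R : realType) (P : probability T R).
Context (n : nat) (xi : 'I_n -> {RV P >-> R}) (mu : 'cV[R]_n) (Sigma : 'M[R]_n).
Hypothesis hxi : is_gaussian_vector xi mu Sigma.

(* Square integrability is implicit in the definition of a Gaussian vector: the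
   variance of [xi i] is the integral of a nonnegative function and it is the
   real number [Sigma i i]. *)
Lemma gaussian_vector_Lfun2 i : (xi i : T -> R) \in Lfun P 2%:E.
Proof.
case: hxi => _ Exi Cxi; apply: (covariance_Lfun2 _ (Exi i)) => //.
by rewrite Cxi ltry.
Qed.

Lemma dotv_rvectE (x : 'cV[R]_n) :
  (fun w => dotv x (rvect xi w)) = \sum_j (x j 0 \o* xi j).
Proof.
apply/funext => w; rewrite /dotv mxE fct_sumE; apply: eq_bigr => j _.
by rewrite !mxE /= mulrC.
Qed.

(** Joint Gaussianity only provides some parameters [m] and [s]; they are identified by computing
    the mean by linearity and the variance by bilinearity. *)
Lemma dotv_rvect_law (x : 'cV[R]_n) :
  has_law P (fun w => dotv x (rvect xi w))
    (gaussian_law (dotv mu x) (Num.sqrt (dotv x (Sigma *m x)))).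
Proof.
case: hxi => /(_ x)[m [s [s0 law]]] Exi Cxi.
have Pfin : P setT \is a fin_num := fin_num_measure P _ measurableT.
have Z2 j : (x j 0 \o* xi j : T -> R) \in Lfun P 2%:E.
  by rewrite Lfun_scale ?ler1n// gaussian_vector_Lfun2.
have Y2 : (fun w => dotv x (rvect xi w)) \in Lfun P 2%:E.
  by rewrite dotv_rvectE rpred_sum// lee1n.
have Y1 := Lfun_subset12 Pfin Y2.
have Em := gaussian_law_mean Y1 s0 law.
have Es := gaussian_law_variance Y1 s0 law.
have xi1 j := Lfun_subset12 Pfin (gaussian_vector_Lfun2 j).
have -> : dotv mu x = m.
  apply: EFin_inj; rewrite -Em dotv_rvectE expectation_sumr; last first.
    by move=> j; exact: Lfun_subset12 (Z2 j).
  rewrite /dotv mxE -sumEFin; apply: eq_bigr => j _.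
  by rewrite expectationZl// Exi !mxE -EFinM mulrC.
suff -> : dotv x (Sigma *m x) = s ^+ 2 by rewrite sqrtr_sqr ger0_norm.
apply: EFin_inj; rewrite -Es dotv_rvectE covariance_suml//; last first.
  by rewrite rpred_sum// lee1n.
rewrite /dotv mxE -sumEFin; apply: eq_bigr => i _.
rewrite covarianceC covariance_suml// ![in LHS]mxE big_distrr/= -sumEFin.
apply: eq_bigr => j _.
rewrite covarianceZl//; last 2 first.
- exact: Lfun_subset12 (Z2 i).
- by apply: Lfun2_mul_Lfun1 => //; exact: gaussian_vector_Lfun2.
rewrite covarianceZr//; last first.
  by apply: Lfun2_mul_Lfun1; exact: gaussian_vector_Lfun2.
by rewrite covarianceC Cxi -!EFinM; congr EFin; ring.
Qed.

End gaussian_vector.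

(** * Quantile inequalities and the second-order cone system *)

Section quantiles.
Context {R : realType}.
Implicit Types (a b m s eps p : R).

Lemma Phi_inv_le p x : 0 < p < 1 -> (x <= Phi_inv p) = (Phi x <= p :> R).
Proof. by move=> p01; rewrite -[in RHS](Phi_invK p01) Phi_le. Qed.

Lemma Phi_inv_ge p x : 0 < p < 1 -> (Phi_inv p <= x) = (p <= Phi x :> R).
Proof. by move=> p01; rewrite -[in RHS](Phi_invK p01) Phi_le. Qed.

Lemma Phi_inv1B p : 0 < p < 1 -> Phi_inv (1 - p) = - Phi_inv p :> R.
Proof.
move=> /[dup] p01 /andP[p0 p1]; have q01 : 0 < 1 - p < 1 by apply/andP; split; lra.
apply: (inc_inj (@Phi_le R)).
by rewrite PhiN !Phi_invK.
Qed.

(** The approximation guarantee in standardised form, with mean 0 and t = 1. *)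
Lemma Phi_itv_ge eps a b : 0 < eps -> eps <= 1 / 2 ->
  a <= Phi_inv eps -> Phi_inv (1 - eps) <= b ->
  a - b <= 2 * Phi_inv (eps / 2) ->
  1 - 5 / 4 * eps <= Phi b - Phi a.
Proof.
move=> e0 e1 ha hb hab.
have E1 : 0 < eps < 1 by apply/andP; split; lra.
have E2 : 0 < 1 - eps < 1 by apply/andP; split; lra.
have E3 : 0 < eps / 2 < 1 by apply/andP; split; lra.
pose q := Phi_inv (1 - eps); pose r := - Phi_inv (eps / 2).
have Phiq : Phi q = 1 - eps by rewrite Phi_invK.
have Phir : Phi r = 1 - eps / 2 by rewrite PhiN Phi_invK.
have q0 : 0 <= q by rewrite -Phi_le Phi0 Phiq; lra.
have qr : q <= r by rewrite -Phi_le Phiq Phir; lra.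
have qa : q <= - a by rewrite /q Phi_inv1B// lerN2.
have conv := Phi_tail_convex q0 qa hb.
(* With d = r - q the outer points are r - d = q and r + d = 2 r - q, and the tails at [q] and [r]
   are eps and eps / 2. *)
have := @Phi_tail_logconcave R r (r - q) ltac:(lra).
have -> : r - (r - q) = q by ring.
rewrite Phiq Phir => lc.
(* This is the length constraint b - a >= 2 r. *)
have mon : Phi (r + (r - q)) <= Phi (- a + b - q).
  by rewrite Phi_le /r; lra.
have {lc} : eps * (1 - Phi (r + (r - q))) <= eps * (eps / 4).
  by move: lc; congr (_ <= _); field.
rewrite ler_pM2l// => lc.
rewrite -[a]opprK PhiN; lra.
Qed.

(** Each one-sided tail is at most [eps]; the third bound compares [a, b] with the centred interval
    of the same length. *)
Lemma Phi_itv_le_Phi_inv eps a b : 0 < eps -> eps <= 1 / 2 ->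
  1 - eps <= Phi b - Phi a ->
  [/\ a <= Phi_inv eps, Phi_inv (1 - eps) <= b
    & a - b <= 2 * Phi_inv (eps / 2)].
Proof.
move=> e0 e1 h.
have E1 : 0 < eps < 1 by apply/andP; split; lra.
have E2 : 0 < 1 - eps < 1 by apply/andP; split; lra.
have E3 : 0 < eps / 2 < 1 by apply/andP; split; lra.
have a0 := Phi_ge0 a; have b1 : Phi b <= 1 by rewrite -subr_ge0 -PhiN Phi_ge0.
split.
- by rewrite Phi_inv_le//; lra.
- by rewrite Phi_inv_ge//; lra.
have ab : a <= b by rewrite -Phi_le; lra.
have hc := Phi_itv_le_centered ab.
suff : - ((b - a) / 2) <= Phi_inv (eps / 2) by lra.
by rewrite Phi_inv_le// PhiN; lra.
Qed.

Lemma gaussian_law_itv m s a b : 0 < s -> a <= b ->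
  gaussian_law m s `[a, b] = (Phi ((b - m) / s) - Phi ((a - m) / s))%:E.
Proof.
move=> s0 ab; rewrite /gaussian_law gt_eqF//.
have -> : `[a, b]%classic = (`]-oo, b] `\` `]-oo, a[)%classic.
  apply/seteqP; split => x /=; rewrite !in_itv/=.
    by move=> /andP[ax xb]; split => //; apply/negP; rewrite -leNgt.
  by move=> [xb /negP]; rewrite -leNgt => ->.
rewrite measureD//; last by rewrite ltey_eq fin_num_measure.
have -> : (`]-oo, b] `&` `]-oo, a[ = `]-oo, a[)%classic.
  apply/setIidPr => x /=; rewrite !in_itv/= => xa.
  by rewrite (le_trans (ltW xa)).
transitivity (normal_prob m s `]-oo, b] - normal_prob m s `]-oo, a])%E.
  by congr (_ - _)%E; exact: normal_prob_rayl.
by rewrite !normal_prob_rayr.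
Qed.

End quantiles.

(** * Second-order cone representation of the feasible set *)

Section soc_representation.
Context {R : realType}.

Lemma is_soc_constraint_affine (V : lmodType R) (g : {linear V -> R^o}) :
  is_soc_constraint [set z | 0 <= g z].
Proof.
(* The norm of an empty vector is 0. *)
exists 0%N, [the {linear V -> 'cV[R]_0} of \0], 0, g, 0.
apply/seteqP; split => z /=; by rewrite /l2norm big_ord0 sqrtr0 addr0.
Qed.

Section feasible.
Context (n : nat) (mu : 'cV[R]_n) (L : 'M[R]_n) (eps : R).
Local Notation V := (R^o * R^o * 'cV[R]_n * R^o)%type.

(** [F] and [g1] are the two sides of the cone constraint; [g2], [g3] and [g4] are the slacks of the
    affine ones. *)
Let F (z : V) : 'cV[R]_n := L^T *m z.1.2.
Let g1 (z : V) : R^o := z.2.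
Let g2 (z : V) : R^o := Phi_inv eps * z.2 - (z.1.1.1 - dotv mu z.1.2).
Let g3 (z : V) : R^o := z.1.1.2 - dotv mu z.1.2 - Phi_inv (1 - eps) * z.2.
Let g4 (z : V) : R^o := 2 * Phi_inv (eps / 2) * z.2 - (z.1.1.1 - z.1.1.2).

Let dotvP (a : R) (x y : 'cV[R]_n) : dotv mu (a *: x + y) = a * dotv mu x + dotv mu y.
Proof. by rewrite /dotv mulmxDr -scalemxAr !mxE. Qed.

Let linF : linear F.
Proof. by move=> a x y; rewrite /F /= mulmxDr -scalemxAr. Qed.
Let ling1 : linear g1. Proof. by []. Qed.
Let ling2 : linear g2.
Proof. by move=> a x y; rewrite /g2 /= dotvP /GRing.scale/=; ring. Qed.
Let ling3 : linear g3.
Proof. by move=> a x y; rewrite /g3 /= dotvP /GRing.scale/=; ring. Qed.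
Let ling4 : linear g4.
Proof. by move=> a x y; rewrite /g4 /= /GRing.scale/=; ring. Qed.

#[local] HB.instance Definition _ := GRing.isLinear.Build _ _ _ _ F linF.
#[local] HB.instance Definition _ := GRing.isLinear.Build _ _ _ _ g1 ling1.
#[local] HB.instance Definition _ := GRing.isLinear.Build _ _ _ _ g2 ling2.
#[local] HB.instance Definition _ := GRing.isLinear.Build _ _ _ _ g3 ling3.
#[local] HB.instance Definition _ := GRing.isLinear.Build _ _ _ _ g4 ling4.

Lemma soc_feasible_set_is_soc : is_soc_set (soc_feasible_set mu L eps).
Proof.
(* The default [setT] is never reached, as i < 4. *)
pose C (i : 'I_4) : set V := nth setT
  [:: [set z | l2norm (F z) <= g1 z]; [set z | 0 <= g2 z];
      [set z | 0 <= g3 z]; [set z | 0 <= g4 z]] i.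
exists 4, C; split.
  move=> [[|[|[|[|//]]]] i4]; rewrite /C/=; try exact: is_soc_constraint_affine.
  exists n, F, 0, g1, 0.
  by apply/seteqP; split => z /=; rewrite !addr0.
apply/seteqP; split => z.
  move=> [h1 h2 h3 h4] [[|[|[|[|//]]]] i4] _ //=; rewrite /C/=.
  - by rewrite /g2 subr_ge0.
  - by rewrite /g3 subr_ge0.
  - by rewrite /g4 subr_ge0.
move=> h; split.
- exact: (h (@Ordinal 4 0 isT) I).
- by have := h (@Ordinal 4 1 isT) I; rewrite /C/= /g2 subr_ge0.
- by have := h (@Ordinal 4 2 isT) I; rewrite /C/= /g3 subr_ge0.
- by have := h (@Ordinal 4 3 isT) I; rewrite /C/= /g4 subr_ge0.
Qed.

End feasible.

End soc_representation.

(** * Intervals under N(m, s^2), degenerate case included *)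

Section gaussian_interval.
Context {R : realType}.
Implicit Types (a b m s t eps : R).

Lemma gaussian_law_itv_quantiles m s a b eps : 0 <= s ->
  0 < eps -> eps <= 1 / 2 ->
  ((1 - eps)%:E <= gaussian_law m s `[a, b])%E ->
  [/\ a - m <= Phi_inv eps * s, Phi_inv (1 - eps) * s <= b - m
    & a - b <= 2 * Phi_inv (eps / 2) * s].
Proof.
move=> s0 e0 e1 h.
(* If b < a the interval is empty, and its mass 0 is below 1 - eps. *)
have [ab|ba] := leP a b; last first.
  move: h; rewrite set_itv_ge ?bnd_simp -?ltNge//.
  rewrite (_ : gaussian_law _ _ _ = 0%E) ?lee_fin; first by lra.
  by rewrite /gaussian_law; case: ifP => _; rewrite measure0.
(* For s = 0, as when x = 0, the Dirac mass forces a <= m <= b. *)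
move: s0; rewrite le_eqVlt => /predU1P[s0|s0].
  move: h; rewrite -s0 /gaussian_law eqxx diracE mem_setE in_itv/= !mulr0.
  case: andP => [[am mb] _|_]; first by split; lra.
  by rewrite lee_fin /=; lra.
move: h; rewrite gaussian_law_itv// lee_fin => /(Phi_itv_le_Phi_inv e0 e1)[].
rewrite ler_pdivrMr// ler_pdivlMr// -mulrBl ler_pdivrMr//.
by rewrite opprB addrA subrK.
Qed.

Lemma gaussian_law_itv_ge m s t a b eps : 0 <= s -> s <= t ->
  0 < eps -> eps <= 1 / 2 ->
  a - m <= Phi_inv eps * t -> Phi_inv (1 - eps) * t <= b - m ->
  a - b <= 2 * Phi_inv (eps / 2) * t ->
  ((1 - 5 / 4 * eps)%:E <= gaussian_law m s `[a, b])%E.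
Proof.
move=> s0 st e0 e1 ha hb hab.
have E1 : 0 < eps < 1 by apply/andP; split; lra.
have E2 : 0 < 1 - eps < 1 by apply/andP; split; lra.
have E3 : 0 < eps / 2 < 1 by apply/andP; split; lra.
have p1 : Phi_inv eps <= 0 :> R by rewrite -Phi_le Phi_invK// Phi0.
have p2 : 0 <= Phi_inv (1 - eps) :> R by rewrite -Phi_le Phi_invK// Phi0; lra.
have p3 : Phi_inv (eps / 2) <= 0 :> R by rewrite -Phi_le Phi_invK// Phi0; lra.
(* Since eps <= 1/2, the signs of the three quantiles let each inequality pass from [t] to the
   smaller [s]. *)
have {}ha : a - m <= Phi_inv eps * s by rewrite (le_trans ha)// ler_wnM2l.
have {}hb : Phi_inv (1 - eps) * s <= b - m by rewrite (le_trans _ hb)// ler_wpM2l.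
have {}hab : a - b <= 2 * Phi_inv (eps / 2) * s.
  by rewrite (le_trans hab)// ler_wnM2l// mulr_ge0_le0.
have am : a <= m by have := mulr_le0_ge0 p1 s0; lra.
have mb : m <= b by have := mulr_ge0 p2 s0; lra.
move: s0; rewrite le_eqVlt => /predU1P[s0|s0].
  rewrite -s0 /gaussian_law eqxx diracE mem_setE in_itv/= am mb.
  by rewrite lee_fin /=; lra.
rewrite gaussian_law_itv ?(le_trans am)// lee_fin.
apply: Phi_itv_ge => //; rewrite ?ler_pdivrMr ?ler_pdivlMr//.
by rewrite -mulrBl ler_pdivrMr// opprB addrA subrK.
Qed.

End gaussian_interval.

Lemma l2norm_cholesky (R : realType) (n : nat) (L : 'M[R]_n) (x : 'cV[R]_n) :
  Num.sqrt (dotv x (L *m L^T *m x)) = l2norm (L^T *m x).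
Proof.
congr Num.sqrt; rewrite /dotv -mulmxA mulmxA -[L in x^T *m L]trmxK -trmx_mul mxE.
by apply: eq_bigr => i _; rewrite mxE expr2.
Qed.

Theorem lemma16 (R : realType) (d : measure_display) (T : measurableType d)
    (P : probability T R) (n : nat) (xi : 'I_n -> {RV P >-> R})
    (mu : 'cV[R]_n) (Sigma L : 'M[R]_n) (eps : R)
    (hxi : is_gaussian_vector xi mu Sigma)
    (hSigma : posdef Sigma)
    (heps0 : 0 < eps) (heps : eps <= 1 / 2)
    (hL : is_cholesky L Sigma) :
  [/\ is_soc_set (soc_feasible_set mu L eps),
      forall (a b : R) (x : 'cV[R]_n),
        ((1 - eps)%:E <= P [set w | a <= dotv x (rvect xi w) <= b]%R)%E ->
        exists t : R, soc_system mu L eps a b x t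
    & forall (a b : R) (x : 'cV[R]_n) (t : R),
        soc_system mu L eps a b x t ->
        ((1 - 5 / 4 * eps)%:E <= P [set w | a <= dotv x (rvect xi w) <= b]%R)%E].
Proof.
(* Both claims reduce to the mass of [a, b] under the law of x^T xi, whose standard deviation is
   |L^T x|. *)
have PE a b x : P [set w | a <= dotv x (rvect xi w) <= b]%R =
    gaussian_law (dotv mu x) (l2norm (L^T *m x)) `[a, b].
  case: hL => _ _ LS; rewrite -l2norm_cholesky LS.
  rewrite -(dotv_rvect_law hxi x (measurable_itv `[a, b])).
  by congr (P _); apply/seteqP; split => w /=; rewrite in_itv.
split; first exact: soc_feasible_set_is_soc.
- move=> a b x; rewrite PE => /gaussian_law_itv_quantiles[]//.
    exact: sqrtr_ge0.
  (* The witness is the smallest [t] that the cone constraint allows. *)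
  by exists (l2norm (L^T *m x)).
- move=> a b x t [st ha hb hab]; rewrite PE.
  by apply: gaussian_law_itv_ge ha hb hab => //; exact: sqrtr_ge0.
Qed.
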